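(* Let $T\in\mathcal{P}\cdot\mathcal{P}$, i.e. $T\in M^n(\mathbb{C})$ is a product $T=P_1P_2$ of two orthogonal projections $P_1,P_2\in M^n(\mathbb{C})$, and let $Q=Q_{\mathcal{R}(T)//\mathcal{N}(T)}$ be the (oblique) projection with range $\mathcal{R}(T)$ and nullspace $\mathcal{N}(T)$. Let $T=U_T|T|$ be the polar decomposition of $T$, and put $V_1=Q-T$ and $V=U_T-T$. Then the following assertions hold: (a) The proper splitting $T=Q-V_1$ is convergent. (b) The proper splitting $T=U_T-V$ is convergent. (c) $\rho(U_T^*V)\leq\rho(Q^\dagger V_1)<1$.
   Context: $M^n(\mathbb{C})$ denotes the complex $n\times n$ matrices; $A^\dagger$ is the Moore-Penrose inverse; $\mathcal{R}(\cdot)$, $\mathcal{N}(\cdot)$, $\rho(\cdot)$ denote range, nullspace and spectral radius. $\mathcal{P}=\{P\in M^n(\mathbb{C}):P=P^2=P^*\}$ and $\mathcal{P}\cdot\mathcal{P}=\{P_1P_2:P_1,P_2\in\mathcal{P}\}$. It is known that if $T\in\mathcal{P}\cdot\mathcal{P}$ then $\mathbb{C}^n$ is the direct sum of $\mathcal{R}(T)$ and $\mathcal{N}(T)$, so that the projection $Q_{\mathcal{R}(T)//\mathcal{N}(T)}$ is well defined. The polar decomposition of $T$ is the unique factorization $T=U_T|T|$ with $|T|=(T^*T)^{1/2}$ and $U_T$ a partial isometry with $\mathcal{R}(U_T)=\mathcal{R}(T)$; it also satisfies $\mathcal{N}(U_T)=\mathcal{N}(T)$, and $U_T^\dagger=U_T^*$.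 A decomposition $T=U-V$ with $U,V\in M^{n}(\mathbb{C})$ is a proper splitting of $T$ if $\mathcal{R}(U)=\mathcal{R}(T)$ and $\mathcal{N}(U)=\mathcal{N}(T)$. The proper splitting $T=U-V$ is called convergent if $\rho(U^\dagger V)<1$. *)

(* Defs.v *)
From mathcomp Require Import all_boot all_order all_algebra.
From mathcomp Require Import complex.
From mathcomp Require Import all_classical all_reals.

Set Implicit Arguments.
Unset Strict Implicit.
Unset Printing Implicit Defensive.

Import Order.TTheory GRing.Theory Num.Theory.
Import ComplexField.Normc.

Local Open Scope classical_set_scope.
Local Open Scope ring_scope.
Local Open Scope sesquilinear_scope.

(* Matrices act on column vectors, so [rangemx] is the column space; the row
   spaces of [mxalgebra] would be the ranges of the transposes. *)
Definition rangemx (C : numClosedFieldType) (m n : nat) (A : 'M[C]_(m, n)) :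
    set 'cV[C]_m :=
  range (fun x : 'cV[C]_n => A *m x).

Definition nullmx (C : numClosedFieldType) (m n : nat) (A : 'M[C]_(m, n)) :
    set 'cV[C]_n :=
  [set x | A *m x = 0].

Definition orthoproj (C : numClosedFieldType) (n : nat) (P : 'M[C]_n) : Prop :=
  P = P *m P /\ P = P ^t*.

Definition orthoproj_product (C : numClosedFieldType) (n : nat)
    (T : 'M[C]_n) : Prop :=
  exists P1 P2 : 'M[C]_n,
    [/\ orthoproj P1, orthoproj P2 & T = P1 *m P2].

Definition is_projection_along (C : numClosedFieldType) (n : nat)
    (Q : 'M[C]_n) (M N : set 'cV[C]_n) : Prop :=
  [/\ Q *m Q = Q, rangemx Q = M & nullmx Q = N].

Definition penrose (C : numClosedFieldType) (m n : nat)
    (A : 'M[C]_(m, n)) (X : 'M[C]_(n, m)) : Prop :=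
  [/\ A *m X *m A = A,
      X *m A *m X = X,
      (A *m X) ^t* = A *m X &
      (X *m A) ^t* = X *m A].

(* The default value 0 is never used: see [mpinvP] and [mpinv_unique]. *)
Definition mpinv (C : numClosedFieldType) (m n : nat) (A : 'M[C]_(m, n)) :
    'M[C]_(n, m) :=
  xget 0 [set X | penrose A X].

Section MoorePenroseTheory.
Variable C : numClosedFieldType.

Lemma adjmxM m n p (A : 'M[C]_(m, n)) (B : 'M[C]_(n, p)) :
  (A *m B) ^t* = B ^t* *m A ^t*.
Proof. by rewrite trmx_mul map_mxM. Qed.

Lemma gram_eq0 m n (A : 'M[C]_(m, n)) : A *m A ^t* = 0 -> A = 0.
Proof.
move=> A0; apply/matrixP => i j; rewrite mxE; apply/eqP.
have /eqP := congr1 (fun M : 'M[C]_m => M i i) A0; rewrite !mxE.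
rewrite psumr_eq0 => [/allP/(_ j (mem_index_enum _))|k _];
  rewrite !mxE -normCK; last exact: exprn_ge0.
by rewrite expf_eq0 /= normr_eq0.
Qed.

Lemma gram_unitmx m n (A : 'M[C]_(m, n)) : row_free A -> A *m A ^t* \in unitmx.
Proof.
move=> Afree; rewrite -row_free_unit -kermx_eq0; apply/eqP.
set K := kermx _; have KA0 : K *m A = 0.
  apply: gram_eq0; rewrite adjmxM mulmxA -(mulmxA K) mulmx_ker mul0mx //.
by apply/eqP; rewrite -(mulmx_free_eq0 K Afree) KA0.
Qed.

Lemma penrose_ex m n (A : 'M[C]_(m, n)) : exists X, penrose A X.
Proof.
have [r [B [D [AE fB fD]]]] : exists r (B : 'M[C]_(m, r)) (D : 'M[C]_(r, n)),
    [/\ A = B *m D, row_full B & row_free D].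
  exists (\rank A), (col_base A), (row_base A); split.
  - by rewrite mulmx_base.
  - exact: col_base_full.
  - exact: row_base_free.
set GD := D *m D ^t*; set GB := B ^t* *m B.
have uD : GD \in unitmx by exact: gram_unitmx.
have uB : GB \in unitmx.
  rewrite /GB -[X in _ *m X]trmxCK; apply: gram_unitmx.
  by rewrite /row_free mxrank_map mxrank_tr.
have hD : GD ^t* = GD by rewrite /GD adjmxM trmxCK.
have hB : GB ^t* = GB by rewrite /GB adjmxM trmxCK.
have adjV k (G : 'M[C]_k) : G ^t* = G -> (invmx G) ^t* = invmx G.
  by move=> hG; rewrite trmx_inv map_invmx hG.
pose X := D ^t* *m invmx GD *m (invmx GB *m B ^t*).
have DX : D *m X = invmx GB *m B ^t*.
  by rewrite /X !mulmxA -/GD mulmxV // mul1mx.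
have XB : X *m B = D ^t* *m invmx GD.
  by rewrite /X -!mulmxA -/GB mulVmx // mulmx1.
have AX : A *m X = B *m (invmx GB *m B ^t*) by rewrite AE -mulmxA DX.
have XA : X *m A = D ^t* *m invmx GD *m D by rewrite AE mulmxA XB.
exists X; split.
- rewrite AX [X in _ *m X]AE AE -!mulmxA (mulmxA (B ^t*)) -/GB.
  by rewrite (mulmxA (invmx GB)) mulVmx // mul1mx.
- by rewrite XA -mulmxA DX.
- by rewrite AX !adjmxM trmxCK adjV // mulmxA.
- by rewrite XA !adjmxM trmxCK adjV // mulmxA.
Qed.

Lemma mpinvP m n (A : 'M[C]_(m, n)) : penrose A (mpinv A).
Proof. by have [X AX] := penrose_ex A; exact: (xgetPex 0 (ex_intro _ X AX)). Qed.

Lemma mpinv_unique m n (A : 'M[C]_(m, n)) X : penrose A X -> X = mpinv A.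
Proof.
case=> a1 a2 a3 a4; have [b1 b2 b3 b4] := mpinvP A; set Y := mpinv A in b1 b2 b3 b4 *.
have AXY : A *m X = A *m Y.
  by rewrite -a3 -{1}b1 -mulmxA adjmxM a3 b3 mulmxA a1.
have XAY : X *m A = Y *m A.
  by rewrite -a4 -{1}b1 -!mulmxA mulmxA adjmxM b4 a4 -mulmxA (mulmxA A) a1.
by rewrite -a2 XAY -mulmxA AXY mulmxA b2.
Qed.

End MoorePenroseTheory.

Definition psdmx (C : numClosedFieldType) (n : nat) (A : 'M[C]_n) : Prop :=
  A ^t* = A /\ forall x : 'cV[C]_n, 0 <= (x ^t* *m A *m x) 0 0.

(* [H] is |A|, the positive semidefinite square root of A^* A. *)
Definition is_absmx (C : numClosedFieldType) (n : nat) (A H : 'M[C]_n) : Prop :=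
  psdmx H /\ H *m H = A ^t* *m A.

(* Isometric on the orthogonal complement of the nullspace. *)
Definition partial_isometry (C : numClosedFieldType) (n : nat)
    (U : 'M[C]_n) : Prop :=
  forall x : 'cV[C]_n,
    (forall y : 'cV[C]_n, nullmx U y -> y ^t* *m x = 0) ->
    (U *m x) ^t* *m (U *m x) = x ^t* *m x.

Definition polar_decomposition (C : numClosedFieldType) (n : nat)
    (T U H : 'M[C]_n) : Prop :=
  [/\ is_absmx T H, partial_isometry U, rangemx U = rangemx T & T = U *m H].

Definition proper_splitting (C : numClosedFieldType) (n : nat)
    (T U V : 'M[C]_n) : Prop :=
  [/\ T = U - V, rangemx U = rangemx T & nullmx U = nullmx T].

(* The set is finite, and empty only if n = 0, in which case its [sup] is 0.
   [eigenvalue] refers to row eigenvectors, which gives the same eigenvalues. *)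
Definition spectral_radius (R : realType) (n : nat) (A : 'M[R[i]]_n) : R :=
  sup [set normc l | l in [set l : R[i] | eigenvalue A l]].

Definition convergent_proper_splitting (R : realType) (n : nat)
    (T U V : 'M[R[i]]_n) : Prop :=
  proper_splitting T U V /\ spectral_radius (mpinv U *m V) < 1.

(* Main.v *)
Require Import Defs.
From mathcomp Require Import all_boot all_order all_algebra.
From mathcomp Require Import complex.
From mathcomp Require Import all_classical all_reals.
From mathcomp Require Import ring.

(* Let P be the orthogonal projection onto the complement of N(T).  Since T is
   a product of two projections, the Moore-Penrose inverse of Q is T^*, so
   Q^+ V1 = P - |T|^2, while U_T^* V = P - |T|.  The eigenvalues of |T| and of
   |T|^2 lie in [0, 1], and neither matrix has a kernel inside the range of P,
   so the eigenvalues of both differences lie in [0, 1[.  Finally an eigenvalue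
   b <> 0 of P - |T| yields the eigenvalue 1 - (1 - b)^2 = b (2 - b) >= b of
   P - |T|^2. *)

Set Implicit Arguments.
Unset Strict Implicit.
Unset Printing Implicit Defensive.

Import Order.TTheory GRing.Theory Num.Theory.
Local Open Scope ring_scope.
Local Open Scope sesquilinear_scope.

(** * Gram matrices, and matrix identities from ranges and nullspaces *)

Section Gram.
Variable C : numClosedFieldType.

Lemma adjmxB m n (A B : 'M[C]_(m, n)) : (A - B) ^t* = A ^t* - B ^t*.
Proof. by rewrite linearB map_mxB. Qed.

Lemma adjmxD m n (A B : 'M[C]_(m, n)) : (A + B) ^t* = A ^t* + B ^t*.
Proof. by rewrite linearD map_mxD. Qed.

Lemma adjmx1 n : (1%:M : 'M[C]_n) ^t* = 1%:M.
Proof. by rewrite trmx1 map_mx1. Qed.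

Lemma gram_ge0 n (v : 'rV[C]_n) : 0 <= (v *m v ^t*) 0 0.
Proof.
by rewrite mxE; apply: sumr_ge0 => j _; rewrite !mxE -normCK exprn_ge0.
Qed.

Lemma gram_gt0 n (v : 'rV[C]_n) : v != 0 -> 0 < (v *m v ^t*) 0 0.
Proof.
move=> v0; rewrite lt_def gram_ge0 andbT; apply: contraNneq v0 => vv0.
by apply/eqP/gram_eq0/matrixP => i j; rewrite !ord1 vv0 mxE.
Qed.

Lemma gramC_eq0 m n (A : 'M[C]_(m, n)) : A ^t* *m A = 0 -> A = 0.
Proof.
move=> A0; rewrite -[A]trmxCK [A ^t*]gram_eq0 ?trmxCK //.
by rewrite trmx0 map_mx0.
Qed.

Lemma eq_mulmx_cV m n (A B : 'M[C]_(m, n)) :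
  (forall x : 'cV[C]_n, A *m x = B *m x) -> A = B.
Proof.
move=> AB; apply/trmx_inj/row_matrixP => i.
by rewrite -!tr_col !colE AB.
Qed.

Lemma rangemx_factor m n p (A : 'M[C]_(m, n)) (B : 'M[C]_(m, p)) :
  (rangemx A `<=` rangemx B)%classic -> exists Z, A = B *m Z.
Proof.
move=> AB; have /choice[f Hf] j : exists x : 'cV[C]_p, B *m x = col j A.
  by have [|x _ <-] := AB (col j A);
    [exists (delta_mx j 0); rewrite ?colE | exists x].
exists (\matrix_(i, j) f j i 0); apply/matrixP => i j.
have := congr1 (fun M : 'cV[C]_m => M i 0) (Hf j); rewrite !mxE => <-.
by apply: eq_bigr => k _; rewrite !mxE.
Qed.

Lemma nullmx_mul0 m n p q (A : 'M[C]_(m, n)) (B : 'M[C]_(p, n))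
    (Y : 'M[C]_(n, q)) :
  (nullmx A `<=` nullmx B)%classic -> A *m Y = 0 -> B *m Y = 0.
Proof.
move=> AB AY0; apply: eq_mulmx_cV => x; rewrite mul0mx -mulmxA.
by apply: AB; rewrite /nullmx /= mulmxA AY0 mul0mx.
Qed.

(** Expanding the form at [x + D *m x] leaves only the two cross terms, each equal to the squared
    norm of [D *m x]. *)
Lemma hermitian_form_eq0 n (D : 'M[C]_n) : D ^t* = D ->
  (forall x : 'cV[C]_n, x ^t* *m D *m x = 0) -> D = 0.
Proof.
move=> hD D0; apply: eq_mulmx_cV => x; rewrite mul0mx; apply: gramC_eq0.
have := D0 (x + D *m x).
rewrite adjmxD !mulmxDl !mulmxDr !D0 add0r addr0 adjmxM hD !mulmxA.
by move/eqP; rewrite -mulr2n -scaler_nat scaler_eq0 pnatr_eq0 => /eqP.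
Qed.

End Gram.

(** * Orthogonal projections, Moore-Penrose inverses and polar factors *)

Section ProjectionProducts.
Variables (C : numClosedFieldType) (n : nat).
Implicit Types (P Q T U H K : 'M[C]_n).

Lemma orthoproj_mpinvl m k (A : 'M[C]_(m, k)) : orthoproj (mpinv A *m A).
Proof. by have [_ h _ h'] := mpinvP A; split; rewrite // mulmxA h. Qed.

Lemma nullmx_mpinvl m k (A : 'M[C]_(m, k)) : nullmx (mpinv A *m A) = nullmx A.
Proof.
have [h _ _ _] := mpinvP A; apply/seteqP; split=> x; rewrite /nullmx /= => Ax.
  by rewrite -h -!mulmxA (mulmxA (mpinv A)) Ax mulmx0.
by rewrite -mulmxA Ax mulmx0.
Qed.

(** Equal nullspaces give [P' = P' *m P] and [P = P *m P'], whose right-hand sides are adjoint to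
    each other. *)
Lemma orthoproj_eq P P' : orthoproj P -> orthoproj P' ->
  nullmx P = nullmx P' -> P = P'.
Proof.
move=> [PP hP] [PP' hP'] NN.
have h : P' *m (1%:M - P) = 0.
  apply: (nullmx_mul0 (A := P)); first by rewrite NN.
  by rewrite mulmxBr mulmx1 -PP subrr.
have h' : P *m (1%:M - P') = 0.
  apply: (nullmx_mul0 (A := P')); first by rewrite NN.
  by rewrite mulmxBr mulmx1 -PP' subrr.
move/eqP: h; rewrite mulmxBr mulmx1 subr_eq0 => /eqP h.
move/eqP: h'; rewrite mulmxBr mulmx1 subr_eq0 => /eqP h'.
by rewrite h' {1}hP hP' -adjmxM -h.
Qed.

(** Every [P *m x] is orthogonal to the nullspace of [U], so the isometry condition gives
    [U ^t* *m U] and [P] the same quadratic form. Once they are equal, [X = U ^t* *m (U *m X)] is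
    the adjoint of [U *m X *m U = U]. *)
Lemma mpinv_partial_isometry U : partial_isometry U -> mpinv U = U ^t*.
Proof.
move=> isoU; have [UXU XUX hUX hXU] := mpinvP U.
have [] := orthoproj_mpinvl U; rewrite -mulmxA in UXU.
set X := mpinv U in UXU XUX hUX hXU *; set P := X *m U in UXU XUX hXU * => PP _.
have UUE : U ^t* *m U = P.
  apply/eqP; rewrite -subr_eq0; apply/eqP; apply: hermitian_form_eq0.
    by rewrite adjmxB adjmxM trmxCK hXU.
  move=> x; have := isoU (P *m x).
  rewrite (mulmxA U) UXU (adjmxM U x) (adjmxM P x) hXU => e.
  have {}e : x ^t* *m U ^t* *m (U *m x) = x ^t* *m P *m (P *m x).
    apply: e => y Uy.
    by rewrite mulmxA -hXU -adjmxM -mulmxA Uy mulmx0 trmx0 map_mx0 mul0mx.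
  apply/eqP; rewrite mulmxBr mulmxBl subr_eq0 mulmxA -mulmxA e.
  by rewrite mulmxA -(mulmxA _ P P) -PP.
by rewrite -[LHS]XUX -UUE -mulmxA -hUX -adjmxM -mulmxA UXU.
Qed.

(* As [Q] is idempotent, [Q^+ = (Q^+ Q)(Q Q^+)]; and [P1 P2 = (Q Q^+)(Q^+ Q)]
   since these are the projections onto [R(T)] and the complement of [N(T)]. *)
Lemma mpinv_oblique T Q : orthoproj_product T ->
  is_projection_along Q (rangemx T) (nullmx T) -> mpinv Q = T ^t*.
Proof.
move=> [P1 [P2 [[PP1 hP1] [PP2 hP2] ET]]] [QQ QT NQT].
have [a1 a2 a3 a4] := mpinvP Q; set X := mpinv Q in a1 a2 a3 a4 *.
have [Z EZ] : exists Z, T = Q *m Z by apply: rangemx_factor; rewrite QT.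
have [Z' EZ'] : exists Z, Q = T *m Z by apply: rangemx_factor; rewrite QT.
have QXT : Q *m X *m T = T by rewrite EZ mulmxA a1.
(* [P1] fixes the range of [T], which is that of [Q]. *)
have P1QX : P1 *m (Q *m X) = Q *m X.
  by rewrite mulmxA EZ' ET !mulmxA -PP1.
have QXP1 : Q *m X *m P1 = Q *m X.
  by rewrite -[LHS]trmxCK adjmxM -hP1 a3 P1QX a3.
have TXQ : T *m (X *m Q) = T.
  apply/eqP; rewrite -subr_eq0 -[X in _ - X]mulmx1 -mulmxBr; apply/eqP.
  apply: (@nullmx_mul0 _ _ _ _ _ Q); first by rewrite NQT.
  by rewrite mulmxBr mulmx1 mulmxA a1 subrr.
(* The range of [P2 - 1%:M] lies in the nullspace of [T], which is that of [Q]. *)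
have XQP2 : X *m Q *m P2 = X *m Q.
  apply/eqP; rewrite -subr_eq0 -[X in _ - X]mulmx1 -mulmxBr -mulmxA.
  suff -> : Q *m (P2 - 1%:M) = 0 by rewrite mulmx0.
  apply: (@nullmx_mul0 _ _ _ _ _ T); first by rewrite NQT.
  by rewrite mulmxBr mulmx1 ET -mulmxA -PP2 subrr.
have P2XQ : P2 *m (X *m Q) = X *m Q.
  by rewrite -[LHS]trmxCK adjmxM a4 -hP2 XQP2 a4.
have ET' : T = Q *m X *m (X *m Q).
  by rewrite -TXQ -{1}QXT ET !mulmxA QXP1 -!mulmxA P2XQ.
have XE : X = X *m Q *m (Q *m X) by rewrite mulmxA -(mulmxA X) QQ a2.
by rewrite ET' adjmxM a3 a4 -XE.
Qed.

Lemma polar_nullmx T U H : polar_decomposition T U H ->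
  [/\ nullmx U = nullmx T, U ^t* *m T = H &
      forall v : 'rV[C]_n,
        v *m H = 0 -> v *m (mpinv U *m U) = 0].
Proof.
move=> [[[hH _] HH] isoU RU TE]; have UE := mpinv_partial_isometry isoU.
have [] := orthoproj_mpinvl U; have [a1 _ _ _] := mpinvP U; rewrite UE in a1 *.
set P := U ^t* *m U => PP hP.
have HPH : H *m P *m H = H *m H.
  by rewrite HH TE adjmxM hH !mulmxA.
have QQ : (1%:M - P) *m (1%:M - P) = 1%:M - P.
  by rewrite mulmxBl mul1mx mulmxBr mulmx1 -PP subrr subr0.
(* The Gram matrix of [(1%:M - P) *m H] is [H *m H - H *m P *m H = 0]. *)
have PH : P *m H = H.
  apply/esym/eqP; rewrite -subr_eq0 -[X in X - _]mul1mx -mulmxBl; apply/eqP/gramC_eq0.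
  rewrite adjmxM adjmxB adjmx1 -hP hH mulmxA -(mulmxA H) QQ.
  by rewrite mulmxBr mulmxBl mulmx1 HPH subrr.
have HP : H *m P = H by rewrite -[LHS]trmxCK adjmxM -hP hH PH hH.
(* Equality of the ranges enters here: with [P *m H = H] it yields [P = H *m Z], so [P] and [H] have
   the same kernels on either side. *)
have [Z EZ] : exists Z, U = T *m Z by apply: rangemx_factor; rewrite RU.
have PE : P = H *m Z by rewrite /P {2}EZ TE !mulmxA PH.
have PE' : P = Z ^t* *m H by rewrite hP PE adjmxM hH.
split; last by move=> v vH; rewrite PE mulmxA vH mul0mx.
  apply/seteqP; split => x; rewrite /nullmx /= => Ux.
    by rewrite TE -HP -!mulmxA Ux !mulmx0.
  have Hx : H *m x = 0.
    by apply: gramC_eq0; rewrite adjmxM hH -mulmxA (mulmxA H) HH -mulmxA Ux !mulmx0.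
  have Px : P *m x = 0 by rewrite PE' -mulmxA Hx mulmx0.
  by rewrite -a1 -(mulmxA U) -/P -mulmxA Px mulmx0.
by rewrite TE mulmxA -/P.
Qed.

Lemma psdmx_eigenvalue_ge0 K c : psdmx K -> eigenvalue K c -> 0 <= c.
Proof.
move=> [_ K0] /eigenvalueP[v vK v0]; have := K0 (v ^t*).
by rewrite trmxCK vK -scalemxAl mxE pmulr_lge0 // gram_gt0.
Qed.

Lemma psdmx_gram m (A : 'M[C]_(m, n)) : psdmx (A ^t* *m A).
Proof.
split=> [|x]; first by rewrite adjmxM trmxCK.
by have := gram_ge0 ((A *m x) ^t*); rewrite trmxCK adjmxM !mulmxA.
Qed.

(** By Pythagoras, the difference is the squared norm of [v *m (1%:M - P)]. *)
Lemma orthoproj_contract P (v : 'rV[C]_n) : orthoproj P ->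
  (v *m P *m (v *m P) ^t*) 0 0 <= (v *m v ^t*) 0 0.
Proof.
move=> [PP hP]; rewrite -subr_ge0.
suff -> : (v *m v ^t*) 0 0 - (v *m P *m (v *m P) ^t*) 0 0 =
    ((v *m (1%:M - P)) *m (v *m (1%:M - P)) ^t*) 0 0 by exact: gram_ge0.
rewrite !adjmxM adjmxB adjmx1 -hP !mulmxA -(mulmxA v P P) -PP.
rewrite -(mulmxA v (1%:M - P)) mulmxBl mul1mx [P *m _]mulmxBr mulmx1 -PP subrr subr0.
by rewrite mulmxBr mulmxBl mulmx1 [RHS]mxE; congr (_ + _); rewrite [RHS]mxE.
Qed.

(** For an eigenvector [v], [c] times its squared norm is the squared norm of [v *m P2 *m P1], and
    neither projection increases norms. *)
Lemma orthoproj_product_eigenvalue_gram T c : orthoproj_product T ->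
  eigenvalue (T ^t* *m T) c -> 0 <= c <= 1.
Proof.
move=> [P1 [P2 [oP1 oP2 ->]]] ev; rewrite (psdmx_eigenvalue_ge0 (psdmx_gram _) ev) /=.
case/eigenvalueP: ev => v; rewrite adjmxM => vK v0.
rewrite -(ler_pM2r (gram_gt0 v0)) mul1r.
have -> : c * (v *m v ^t*) 0 0 = (v *m P2 *m P1 *m (v *m P2 *m P1) ^t*) 0 0.
  transitivity (((c *: v) *m v ^t*) 0 0); first by rewrite -scalemxAl [RHS]mxE.
  by rewrite -vK !adjmxM -oP1.2 -oP2.2 !mulmxA.
exact: le_trans (orthoproj_contract _ oP1) (orthoproj_contract _ oP2).
Qed.

Lemma eigenvalue_sqr H c : eigenvalue H c -> eigenvalue (H *m H) (c ^+ 2).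
Proof.
move=> /eigenvalueP[v vH v0]; apply/eigenvalueP; exists v => //.
by rewrite mulmxA vH -scalemxAl vH scalerA.
Qed.

(** Since [(P - K) *m P = P - K], dividing by [a] shows that [P] fixes [v]. *)
Lemma eigenvector_sub P K (v : 'rV[C]_n) a : P *m P = P -> K *m P = K ->
  a != 0 -> v *m (P - K) = a *: v -> v *m P = v /\ v *m K = (1 - a) *: v.
Proof.
move=> PP KP a0 va.
have vP : v *m P = v.
  by apply: (scalerI a0); rewrite scalemxAl -va -mulmxA mulmxBl PP KP.
split=> //; move: va; rewrite mulmxBr vP scalerBl scale1r => <-.
by rewrite opprB addrC subrK.
Qed.

(** For [a != 0], [1 - a] is an eigenvalue of [K], so [0 <= a <= 1]; and [a = 1] would give
    [v *m K = 0], hence [v = v *m P = 0]. *)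
Lemma eigenvalue_sub P K a : P *m P = P -> K *m P = K ->
  (forall v : 'rV[C]_n, v *m K = 0 -> v *m P = 0) ->
  (forall c, eigenvalue K c -> 0 <= c <= 1) ->
  eigenvalue (P - K) a -> 0 <= a < 1.
Proof.
move=> PP KP KP0 K01 /eigenvalueP[v va v0].
have [->|a0] := eqVneq a 0; first by rewrite lexx ltr01.
have [vP vK] := eigenvector_sub PP KP a0 va.
have /K01/andP[a1 a2] : eigenvalue K (1 - a) by apply/eigenvalueP; exists v.
rewrite -[X in X < 1]subr0 in a1 *; rewrite subr_ge0 in a1.
rewrite lt_def subr0 a1 andbT; apply/andP; split.
  by move: a2; rewrite lerBlDr lerDl.
apply: contraNneq v0 => a_1; rewrite -vP; apply/eqP/KP0.
by rewrite vK -a_1 subrr scale0r.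
Qed.

End ProjectionProducts.

(** * Bounds on the spectral radius *)

Section SpectralRadius.
Variables (R : realType) (n : nat).
Implicit Type A : 'M[R[i]]_n.

(** The list consists of the roots of the characteristic polynomial. Finiteness bounds the set under
    the [sup] and lets strict bounds pass to it. *)
Lemma eigenvalue_seq (F : closedFieldType) (A : 'M[F]_n) :
  exists s : seq F, forall a, eigenvalue A a -> a \in s.
Proof.
have [s E] := closed_field_poly_normal (char_poly A); exists s => a.
rewrite eigenvalue_root_char E (monicP (char_poly_monic A)).
by rewrite scale1r root_prod_XsubC.
Qed.

Lemma spectral_radius_le A (r : R) : 0 <= r ->
  (forall a, eigenvalue A a -> `|a| <= r%:C%C) -> spectral_radius A <= r.
Proof.
move=> r0 Ar; rewrite /spectral_radius; set S := [set _ | _ in _]%classic.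
(* An empty spectrum has [sup] 0, whence the hypothesis [0 <= r]. *)
have [->|S0] := pselect (S = set0); first by rewrite sup0.
apply: ge_sup; first exact/set0P/eqP.
by move=> _ [a /Ar aa <-]; rewrite -lecR.
Qed.

Lemma spectral_radius_lt A (r : R) : 0 < r ->
  (forall a, eigenvalue A a -> `|a| < r%:C%C) -> spectral_radius A < r.
Proof.
move=> r0 Ar; have [s sP] := eigenvalue_seq A.
(* A finite maximum with default 0 stays strictly below [r]; the filter is there because [s] is only
   known to contain the eigenvalues. *)
pose c := \big[Num.max/0]_(a <- s | eigenvalue A a) ComplexField.Normc.normc a.
apply: (@le_lt_trans _ _ c).
  apply: spectral_radius_le => [|a Aa]; first exact: bigmax_ge_id.
  (* The norm of [R[i]] is by definition the real [normc] embedded in [R[i]]. *)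
  by rewrite -[leLHS]/((_)%:C%C) lecR; apply: le_bigmax_seq => //; apply: sP.
by apply: bigmax_lt => // a /Ar; rewrite -[ltLHS]/((_)%:C%C) ltcR.
Qed.

Lemma le_spectral_radius A a : eigenvalue A a ->
  `|a| <= (spectral_radius A)%:C%C.
Proof.
move=> Aa; have [s sP] := eigenvalue_seq A.
rewrite -[leLHS]/((_)%:C%C) lecR; apply: ub_le_sup; last by exists a.
exists (\big[Num.max/0]_(a <- s) ComplexField.Normc.normc a) => _ [b Ab <-].
by apply: le_bigmax_seq => //; apply: sP.
Qed.

Lemma spectral_radius_ge0 A : 0 <= spectral_radius A.
Proof.
rewrite /spectral_radius; set S := [set _ | _ in _]%classic.
have [->|/eqP/set0P[_ [a Aa _]]] := pselect (S = set0); first by rewrite sup0.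
by have := le_trans (normr_ge0 a) (le_spectral_radius Aa); rewrite lecR.
Qed.

End SpectralRadius.

Theorem proposition7p4 (R : realType) (n : nat) (T Q UT absT V1 V : 'M[R[i]]_n)
    (hT : orthoproj_product T)
    (hQ : is_projection_along Q (rangemx T) (nullmx T))
    (hpolar : polar_decomposition T UT absT)
    (hV1 : V1 = Q - T)
    (hV : V = UT - T) :
  [/\ convergent_proper_splitting T Q V1,
      convergent_proper_splitting T UT V &
      spectral_radius (UT ^t* *m V) <= spectral_radius (mpinv Q *m V1) < 1].
Proof.
have [NU UH HP0] := polar_nullmx hpolar.
have [[psdH HH] isoU RU TE] := hpolar; have [hH _] := psdH.
have UE := mpinv_partial_isometry isoU.
have [QQ RQ NQ] := hQ; have QE := mpinv_oblique hT hQ.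
have [PP hP] := orthoproj_mpinvl UT.
(* Both are orthogonal projections with the nullspace of [T], so a single [P] serves both
   splittings. *)
have PE : mpinv Q *m Q = mpinv UT *m UT.
  apply: orthoproj_eq; try exact: orthoproj_mpinvl.
  by rewrite !nullmx_mpinvl NQ NU.
set P := mpinv UT *m UT in PP hP PE HP0.
have EA : mpinv Q *m V1 = P - absT *m absT by rewrite hV1 mulmxBr PE QE HH.
have EB : UT ^t* *m V = P - absT by rewrite hV mulmxBr UH /P UE.
have PH : P *m absT = absT by rewrite /P UE -mulmxA -TE.
have HP : absT *m P = absT by rewrite -[LHS]trmxCK adjmxM -hP hH PH hH.
have HH01 c : eigenvalue (absT *m absT) c -> 0 <= c <= 1.
  by rewrite HH; exact: orthoproj_product_eigenvalue_gram.
have H01 c : eigenvalue absT c -> 0 <= c <= 1.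
  move=> ev; have c0 := psdmx_eigenvalue_ge0 psdH ev.
  by rewrite c0 -(expr_le1 (n := 2)) //; case/andP: (HH01 _ (eigenvalue_sqr ev)).
have evB b : eigenvalue (P - absT) b -> 0 <= b < 1 by exact: eigenvalue_sub.
have evA a : eigenvalue (P - absT *m absT) a -> 0 <= a < 1.
  apply: (@eigenvalue_sub _ _ P (absT *m absT) a (esym PP) _ _ HH01).
    by rewrite -mulmxA HP.
  (* The Gram matrix of [v *m absT] is [v *m absT *m absT *m v ^t*], so [absT] and its square have
     the same left kernel. *)
  move=> v vHH; apply: HP0; apply: gram_eq0.
  by rewrite adjmxM hH mulmxA -(mulmxA v) vHH mul0mx.
have rhoA : spectral_radius (mpinv Q *m V1) < 1.
  rewrite EA; apply: spectral_radius_lt => [|a /evA/andP[a0 a1]]; first exact: ltr01.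
  by rewrite ger0_norm.
have rhoBA : spectral_radius (UT ^t* *m V) <= spectral_radius (mpinv Q *m V1).
  rewrite EA EB; apply: spectral_radius_le => [|b evb].
    exact: spectral_radius_ge0.
  have [->|b0] := eqVneq b 0.
    by rewrite normr0 lecR spectral_radius_ge0.
  have /andP[b_ge0 b_lt1] := evB b evb.
  have /eigenvalueP[v vb v0] := evb.
  have [vP vH] := eigenvector_sub (esym PP) HP b0 vb.
  have : eigenvalue (P - absT *m absT) (b * (2 - b)).
    apply/eigenvalueP; exists v => //.
    rewrite mulmxBr vP mulmxA vH -scalemxAl vH scalerA -{1}[v]scale1r -scalerBl.
    by congr (_ *: _); ring.
  move=> /le_spectral_radius; apply: le_trans.
  have b2 : 1 <= 2 - b by rewrite (_ : 2 - b = 1 + (1 - b)) ?lerDl ?subr_ge0 ?ltW //; ring.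
  by rewrite normrM ler_peMr // ger0_norm // (le_trans ler01).
split; last by rewrite rhoBA.
- by split=> //; split=> //; rewrite hV1 opprB addrC subrK.
(* As [mpinv UT = UT ^t*], convergence of this splitting is read off from (c). *)
- split; last by rewrite UE (le_lt_trans rhoBA).
  by split=> //; rewrite hV opprB addrC subrK.
Qed.
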